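(* Consider the planar restricted circular three body problem with its Poincaré map $P:\Sigma\to\Sigma$, $\Sigma=\{y=0\}$, in coordinates $(x,p_x,p_y)$. Let $I$ and $J_0,J_1$ be closed intervals such that $J_0,J_1$ have the same center point $p_y^0$ and $J_0\subset J_1$. Let $x^0$ be the center point of $I$. Let $a\in\mathbb{R}$ and let $U_0,U\subset\Sigma=\mathbb{R}^3$ be defined as $$U_0=\{x^0\}\times\{0\}\times J_0,\qquad U=\left\{(x,0,p_y)\ :\ x\in I,\ p_y=a(x-x^0)+\iota,\ \iota\in J_1\right\}.$$ If $$N:=p_y^0-\left[\frac{\pi_{p_x}P(x^0,0,p_y^0)}{dP(U_0)_{2\,3}}\right]\subset J_0$$ and $$|\alpha-a|<\frac{1}{|I|}\left(|J_1|-|J_0|\right)\quad\text{for all }\alpha\in[\underline{\alpha},\overline{\alpha}]:=\left[-\frac{dP(U)_{2\,1}}{dP(U)_{2\,3}}\right],$$ then there exists a smooth function $\kappa:I\to\mathbb{R}$ such that for any $x\in I$ the point $q(x)=(x,0,0,\kappa(x))$ lies on an $S$-symmetric periodic orbit of the system. Moreover, $\kappa'(x)\in[\underline{\alpha},\overline{\alpha}]$ and $q(x)\in U$ for all $x\in I$.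
   Context: The planar restricted circular three body problem with mass parameter $\mu$ (in the paper $\mu=0.0009537$) is the Hamiltonian system $\dot q=J\nabla H(q)$, $q=(x,y,p_x,p_y)\in\mathbb{R}^4$, $J=\begin{pmatrix}0&\mathrm{id}\\-\mathrm{id}&0\end{pmatrix}$ ($\mathrm{id}$ the $2\times2$ identity), where $$H(x,y,p_x,p_y)=\frac{(p_x+y)^2+(p_y-x)^2}{2}-\Omega(x,y),\qquad \Omega(x,y)=\frac{x^2+y^2}{2}+\frac{1-\mu}{r_1}+\frac{\mu}{r_2},$$ $r_1=\sqrt{(x-\mu)^2+y^2}$, $r_2=\sqrt{(x+1-\mu)^2+y^2}$. The system is reversible with respect to $S(x,y,p_x,p_y)=(x,-y,-p_x,p_y)$: its flow satisfies $S(\phi(t,q))=\phi(-t,S(q))$. An orbit $q(t)$ is $S$-symmetric when $S(q(t))=q(-t)$. $P$ is the Poincaré (first return) map of the section $\Sigma=\{y=0\}$, regarded as a map from $\mathbb{R}^3$ to $\mathbb{R}^3$ with coordinates $(x,p_x,p_y)$; it is assumed to be well defined and smooth in a neighbourhood of the sets considered. $DP=(dP_{i\,j})_{i,j=1,2,3}$ is its derivative, with indexes $1,2,3$ corresponding to $x,p_x,p_y$. For a set $V$, $dP(V)_{i\,j}$ denotes the interval enclosure of $dP_{i\,j}$ on $V$, i.e. the interval $[\inf_V dP_{i\,j},\sup_V dP_{i\,j}]$; quotients of intervals are taken in the sense of interval arithmetic (set of all quotients), $[\cdot]$ denotes an interval enclosure, and writing a quotient presupposes that the denominator interval does not contain $0$.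 $|I|$ denotes the length of an interval; intervals are nondegenerate. A point $(x,0,p_y)\in\Sigma$ is identified with $(x,0,0,p_y)\in\mathbb{R}^4$. *)

(* Defs.v *)
From HB Require Import structures.
From mathcomp Require Import all_boot all_order all_algebra.
From mathcomp Require Import all_classical all_reals all_analysis.
Set Implicit Arguments.
Unset Strict Implicit.
Unset Printing Implicit Defensive.
Import Order.TTheory GRing.Theory Num.Theory.
Import numFieldNormedType.Exports.
Local Open Scope classical_set_scope.
Local Open Scope ring_scope.

Definition vec3 (R : realType) (a b c : R) : 'rV[R]_3 :=
  \row_(i < 3) [:: a; b; c]`_i.
Definition vec4 (R : realType) (a b c d : R) : 'rV[R]_4 :=
  \row_(i < 4) [:: a; b; c; d]`_i.

(* A state q : 'rV_4 lists (x, y, p_x, p_y) in this order; a point of the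
   section {y = 0}, seen in R^3, lists (x, p_x, p_y). *)
Definition cx (R : realType) (q : 'rV[R]_4) : R := q 0 (inord 0).
Definition cy (R : realType) (q : 'rV[R]_4) : R := q 0 (inord 1).
Definition cpx (R : realType) (q : 'rV[R]_4) : R := q 0 (inord 2).
Definition cpy (R : realType) (q : 'rV[R]_4) : R := q 0 (inord 3).

Definition i_x : 'I_3 := inord 0.
Definition i_px : 'I_3 := inord 1.
Definition i_py : 'I_3 := inord 2.

Definition of_section (R : realType) (s : 'rV[R]_3) : 'rV[R]_4 :=
  vec4 (s 0 i_x) 0 (s 0 i_px) (s 0 i_py).

Definition partial (R : realType) (n : nat) (i : 'I_n.+1)
    (f : 'rV[R]_n.+1 -> R) : 'rV[R]_n.+1 -> R :=
  fun q => 'D_(delta_mx 0 i) f q.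

Definition grad (R : realType) (n : nat) (f : 'rV[R]_n.+1 -> R)
    (q : 'rV[R]_n.+1) : 'rV[R]_n.+1 := \row_i partial i f q.

(* Smoothness is C^oo: iterated partial derivatives of all orders are
   (Frechet) differentiable, hence continuous, on the open set W. *)
Definition smooth_on (R : realType) (n : nat) (W : set 'rV[R]_n.+1)
    (f : 'rV[R]_n.+1 -> R) : Prop :=
  forall (s : seq 'I_n.+1) (q : 'rV[R]_n.+1), W q ->
    differentiable (foldr (@partial R n) f s) q.

Definition smooth_map_on (R : realType) (n m : nat) (W : set 'rV[R]_n.+1)
    (F : 'rV[R]_n.+1 -> 'rV[R]_m.+1) : Prop :=
  forall i, smooth_on W (fun q => F q 0 i).

(* A function on a closed set A is smooth when it is the restriction of a
   function that is C^oo on an open neighbourhood of A. *)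
Definition smooth_near (R : realType) (A : set R) (k : R -> R) : Prop :=
  exists O : set R, [/\ open O, A `<=` O &
    forall (n : nat) (x : R), O x -> derivable (derive1n n k) x 1].

Definition r1 (R : realType) (mu : R) (q : 'rV[R]_4) : R :=
  Num.sqrt ((cx q - mu) ^+ 2 + cy q ^+ 2).
Definition r2 (R : realType) (mu : R) (q : 'rV[R]_4) : R :=
  Num.sqrt ((cx q + 1 - mu) ^+ 2 + cy q ^+ 2).

Definition Omega (R : realType) (mu : R) (q : 'rV[R]_4) : R :=
  (cx q ^+ 2 + cy q ^+ 2) / 2 + (1 - mu) / r1 mu q + mu / r2 mu q.

Definition Ham (R : realType) (mu : R) (q : 'rV[R]_4) : R :=
  ((cpx q + cy q) ^+ 2 + (cpy q - cx q) ^+ 2) / 2 - Omega mu q.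

Definition Jmx (R : realType) : 'M[R]_4 :=
  block_mx (0 : 'M[R]_2) (1%:M : 'M[R]_2) (- 1%:M : 'M[R]_2) (0 : 'M[R]_2).

Definition vector_field (R : realType) (mu : R) (q : 'rV[R]_4) : 'rV[R]_4 :=
  (Jmx R *m (grad (Ham mu) q)^T)^T.

(* The phase space of the system excludes the collisions r1 = 0, r2 = 0, where
   the total division makes the values of Ham meaningless. *)
Definition solution_on (R : realType) (mu : R) (D : set R)
    (q : R -> 'rV[R]_4) : Prop :=
  forall t, D t -> [/\ r1 mu (q t) != 0, r2 mu (q t) != 0 &
    is_derive t 1 q (vector_field mu (q t))].

(* The first time tau > 0 at which the orbit of s meets {y = 0} again exists,
   and the orbit is then at s'. The orbit lives on an open interval of times
   containing [0, tau]. *)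
Definition first_return (R : realType) (mu : R) (s s' : 'rV[R]_3) : Prop :=
  exists (q : R -> 'rV[R]_4) (tau e : R),
    [/\ 0 < tau /\ 0 < e,
        solution_on mu `]- e, tau + e[ q,
        q 0 = of_section s,
        (forall t, 0 < t < tau -> cy (q t) != 0) &
        q tau = of_section s'].

Definition Ssym (R : realType) (q : 'rV[R]_4) : 'rV[R]_4 :=
  vec4 (cx q) (- cy q) (- cpx q) (cpy q).

Definition periodic_orbit (R : realType) (mu : R) (q : R -> 'rV[R]_4) : Prop :=
  [/\ solution_on mu setT q,
      exists2 T : R, 0 < T & forall t, q (t + T) = q t &
      exists t, q t <> q 0].

Definition S_symmetric (R : realType) (q : R -> 'rV[R]_4) : Prop :=
  forall t, Ssym (q t) = q (- t).

Definition dP (R : realType) (P : 'rV[R]_3 -> 'rV[R]_3) (i j : 'I_3)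
    (s : 'rV[R]_3) : R :=
  partial j (fun s' => P s' 0 i) s.

Definition dP_encl (R : realType) (P : 'rV[R]_3 -> 'rV[R]_3)
    (V : set 'rV[R]_3) (i j : 'I_3) : set R :=
  `[inf (dP P i j @` V), sup (dP P i j @` V)].

Definition iquot (R : realType) (A B : set R) : set R :=
  [set z | exists a b, [/\ A a, B b & z = a / b]].

Definition U0_set (R : realType) (x0 : R) (J0 : set R) : set 'rV[R]_3 :=
  [set s | exists2 py, J0 py & s = vec3 x0 0 py].

Definition U_set (R : realType) (x0 a : R) (I J1 : set R) : set 'rV[R]_3 :=
  [set s | exists x iota, [/\ I x, J1 iota &
    s = vec3 x 0 (a * (x - x0) + iota)]].

(* Main.v *)
Require Import Defs.
From HB Require Import structures.
From mathcomp Require Import all_boot all_order all_algebra.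
From mathcomp Require Import all_classical all_reals all_analysis.
From mathcomp Require Import lra ring.
Set Implicit Arguments.
Unset Strict Implicit.
Unset Printing Implicit Defensive.
Import Order.TTheory GRing.Theory Num.Theory.
Import numFieldNormedType.Exports.
Local Open Scope classical_set_scope.
Local Open Scope ring_scope.

(* If pi_{p_x} P (x, 0, p_y) = 0, then both endpoints of the return orbit of
   (x, 0, p_y) are fixed by S, and reflecting that orbit about its two endpoints
   extends it to an S-symmetric periodic orbit.  The interval Newton condition gives
   such a point at x = x^0 with p_y in J_0.  In the skew coordinates
   (x, iota) with p_y = a (x - x^0) + iota, the curve of solutions has slope
   alpha - a, which is less than M = (|J_1| - |J_0|) / |I| in absolute value;
   hence over I it stays in a cone of slope M around the initial solution, which
   does not leave I x J_1. *)

(** * Reversibility and symmetric orbits *)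

(** A local implicit function theorem would give only a germ of curve at [x0], still to be continued
    across all of [I]. One inequality [|Fx| < M * Fi] on a rectangle replaces it: it gives a zero
    over each abscissa, a Lipschitz bound on zeros, and from these the derivative of the curve. The
    value of [M] is exactly adapted to the data: as [J0] and [J1] share their center, a cone of
    slope [M] opened at a point of [J0] rises over half of [I] by [M * |I| / 2], which is the margin
    left between [J0] and [J1] on each side. Two obstacles shape the rest. The sign of [dP_23] is
    unknown, so the [p_x] component of [P] is divided by a suitable nonzero number before any
    monotonicity is used. And smoothness on the closed [I] means smoothness on an open
    neighbourhood, while the bounds are given over [I] only; the cone inequality, being strict,
    persists on a larger rectangle by compactness. *)

Lemma is_derive_mx (R : realType) (V : normedModType R) (m n : nat)
    (M : V -> 'M[R]_(m, n)) (dM : 'M[R]_(m, n)) (t v : V) :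
  (forall i j, is_derive t v (fun x => M x i j) (dM i j)) ->
  is_derive t v M dM.
Proof.
move=> h; have dv : derivable M t v.
  by apply/derivable_mxP => i j; have [] := h i j.
split=> //; rewrite derive_mx//; apply/matrixP => i j.
by rewrite mxE; have [_ ->] := h i j.
Qed.

Lemma is_derive_mx_coef (R : realType) (V : normedModType R) (m n : nat)
    (M : V -> 'M[R]_(m, n)) (dM : 'M[R]_(m, n)) (t v : V) i j :
  is_derive t v M dM -> is_derive t v (fun x => M x i j) (dM i j).
Proof.
move=> [dv <-]; rewrite derive_mx// mxE; apply: derivableP.
by move/derivable_mxP : dv; apply.
Qed.

Lemma is_derive_affine (R : realType) (u v t : R) :
  is_derive t 1 (fun s => u + s * v) v.
Proof.
have -> : (fun s => u + s * v) = cst u + (v \*: id).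
  by apply/funext => s; rewrite mulrC.
apply: (is_derive_eq (is_deriveD (is_derive_cst u t 1)
  (is_deriveZ v (is_derive_id t 1)))).
by rewrite add0r /GRing.scale/= mulr1.
Qed.

(** Every difference quotient of [q] at [t] is one of [q1] or one of [q2], and both families tend to
    [d]. This joins two arcs without one-sided derivatives. *)
Lemma is_derive_glue (R : realType) (W : normedModType R) (q q1 q2 : R -> W)
    (t : R) (d : W) :
  is_derive t 1 q1 d -> is_derive t 1 q2 d -> q1 t = q t -> q2 t = q t ->
  (\forall y \near t, q y = q1 y \/ q y = q2 y) ->
  is_derive t 1 q d.
Proof.
move=> [d1 e1] [d2 e2] q1t q2t qE.
suff h : (fun h => h^-1 *: ((q \o shift t) (h *: 1) - q t)) @ 0^' --> d.
  by split; [apply/cvg_ex; exists d|apply/cvg_lim].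
have {d1 e1}h1 : (fun h => h^-1 *: ((q1 \o shift t) (h *: 1) - q1 t)) @ 0^' --> d.
  by rewrite -e1.
have {d2 e2}h2 : (fun h => h^-1 *: ((q2 \o shift t) (h *: 1) - q2 t)) @ 0^' --> d.
  by rewrite -e2.
have {}qE : \forall h \near 0^', q (h *: 1 + t) = q1 (h *: 1 + t) \/
    q (h *: 1 + t) = q2 (h *: 1 + t).
  case: qE => r r0 hr; exists r => // h; rewrite /ball_/= sub0r normrN => hlt _.
  by apply: hr; rewrite /ball_/= [_ *: _]mulr1 opprD addrCA subrr addr0 normrN.
apply/cvgrPdist_lt => e e0.
near=> h.
have : q (h *: 1 + t) = q1 (h *: 1 + t) \/ q (h *: 1 + t) = q2 (h *: 1 + t).
  by near: h; exact: qE.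
rewrite /=; case=> ->; rewrite -?q1t -?q2t.
  near: h; move/cvgrPdist_lt : h1; exact.
rewrite q1t -q2t.
near: h; move/cvgrPdist_lt : h2; exact.
Unshelve. all: by end_near. Qed.

(** Where the derivative does not exist, both sides are the default value 0. The gradient of the
    Hamiltonian can thus be reflected at every state, collisions included. *)
Lemma derive_oppr (R : realType) (V : normedModType R) (f : V -> R) (a v : V) :
  'D_(- v) f a = - 'D_v f a.
Proof.
have key w : derivable f a w -> is_derive a (- w) f (- 'D_w f a).
  move=> dw.
  suff h : (fun h => h^-1 *: ((f \o shift a) (h *: - w) - f a)) @ 0^'
      --> - 'D_w f a.
    by split; [apply/cvg_ex; exists (- 'D_w f a)|apply/cvg_lim].
  apply/cvgrPdist_lt => e e0; move/cvgrPdist_lt : dw => /(_ e e0)[r r0 hr].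
  exists r => // h; rewrite /ball_/= sub0r normrN => hlt h0.
  have := hr (- h); rewrite /ball_/= sub0r opprK oppr_eq0 => /(_ hlt h0).
  rewrite -normrN opprD invrN scaleNr scalerN scaleNr !opprK.
  by [].
have [dv|ndv] := pselect (derivable f a v); first by have [] := key _ dv.
have ndv' : ~ derivable f a (- v).
  by move=> /key []; rewrite opprK.
by rewrite /derive (dvgP ndv) (dvgP ndv') /point/= oppr0.
Qed.

Section Reversibility.
Variables (R : realType) (mu : R).
Implicit Types q : 'rV[R]_4.

Lemma vec4E (a b c d : R) i : vec4 a b c d 0 i = [:: a; b; c; d]`_i.
Proof. by rewrite mxE. Qed.

Lemma cxS q : cx (Ssym q) = cx q.
Proof. by rewrite /cx vec4E inordK. Qed.
Lemma cyS q : cy (Ssym q) = - cy q.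
Proof. by rewrite /cy vec4E inordK. Qed.
Lemma cpxS q : cpx (Ssym q) = - cpx q.
Proof. by rewrite /cpx vec4E inordK. Qed.
Lemma cpyS q : cpy (Ssym q) = cpy q.
Proof. by rewrite /cpy vec4E inordK. Qed.
Definition coordS := (cxS, cyS, cpxS, cpyS).

Lemma r1S q : r1 mu (Ssym q) = r1 mu q.
Proof. by rewrite /r1 !coordS sqrrN. Qed.
Lemma r2S q : r2 mu (Ssym q) = r2 mu q.
Proof. by rewrite /r2 !coordS sqrrN. Qed.

Lemma HamS q : Ham mu (Ssym q) = Ham mu q.
Proof.
by rewrite /Ham /Omega r1S r2S !coordS sqrrN -opprD sqrrN.
Qed.

Lemma SsymE q i : Ssym q 0 i = (-1) ^+ ((i : nat) \in [:: 1; 2]%N) * q 0 i.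
Proof.
rewrite vec4E /cx /cy /cpx /cpy.
by case: i => -[|[|[|[|//]]]] lti /=;
  rewrite ?(expr0, expr1, mul1r, mulN1r); do ?congr (- _);
  congr (q 0 _); apply/val_inj; rewrite /= inordK.
Qed.

Lemma SsymK : involutive (@Ssym R).
Proof. by move=> q; apply/rowP => i; rewrite !SsymE mulrA -expr2 sqrr_sign mul1r. Qed.

(** As [Ham] is invariant under [S], its difference quotients at [S q] along a basis vector are
    those at [q] along the image of that vector, which is the same vector up to sign. *)
Lemma partial_HamS i q :
  partial i (Ham mu) (Ssym q) =
  (-1) ^+ ((i : nat) \in [:: 1; 2]%N) * partial i (Ham mu) q.
Proof.
rewrite /partial.
have -> : 'D_(delta_mx 0 i) (Ham mu) (Ssym q)
    = 'D_((-1) ^+ ((i : nat) \in [:: 1; 2]%N) *: delta_mx 0 i) (Ham mu) q.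
  rewrite /derive; set g1 := (X in lim (X @ _)); set g2 := (X in _ = lim (X @ _)).
  suff -> : g1 = g2 by []; apply/funext => h; rewrite /g1 /g2 /=.
  congr (_ *: (_ - _)); last exact: HamS.
  rewrite -HamS; congr (Ham mu _); apply/rowP => j.
  rewrite !(SsymE, mxE) mulrDr !mulrA -expr2 sqrr_sign mul1r eqxx/=; congr (_ + _).
  by case: eqP => [->|]; rewrite ?(mulr0, mulr1)// mulrC.
case: (_ \in _); first by rewrite expr1 scaleN1r mulN1r derive_oppr.
by rewrite expr0 scale1r mul1r.
Qed.

Lemma JmxE (i j : 'I_4) :
  Jmx R i j = (j == i + 2 :> nat)%N%:R - (i == j + 2 :> nat)%N%:R.
Proof.
rewrite /Jmx.
case: (@split_ordP 2 2 i) => i' ->; case: (@split_ordP 2 2 j) => j' ->.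
- apply: etrans (block_mxEul _ _ _ _ _ _) _; rewrite mxE.
  by case: i' j' => -[|[|//]] ? [[|[|//]]] ? /=; rewrite subrr.
- apply: etrans (block_mxEur _ _ _ _ _ _) _; rewrite mxE.
  by case: i' j' => -[|[|//]] ? [[|[|//]]] ? /=; rewrite subr0.
- apply: etrans (block_mxEdl _ _ _ _ _ _) _; rewrite !mxE.
  by case: i' j' => -[|[|//]] ? [[|[|//]]] ? /=; rewrite sub0r.
- apply: etrans (block_mxEdr _ _ _ _ _ _) _; rewrite mxE.
  by case: i' j' => -[|[|//]] ? [[|[|//]]] ? /=; rewrite subrr.
Qed.

(** [J] couples the indices 0 with 2 and 1 with 3, and [S] changes the sign of exactly one index in
    each pair; hence [J S = - S J], while the gradient commutes with [S]. *)
Lemma vector_fieldS q : vector_field mu (Ssym q) = - Ssym (vector_field mu q).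
Proof.
have E p i : vector_field mu p 0 i
    = \sum_(j < 4) ((j == i + 2 :> nat)%N%:R - (i == j + 2 :> nat)%N%:R)
        * partial j (Ham mu) p.
  by rewrite mxE mxE; apply: eq_bigr => j _; rewrite JmxE mxE mxE.
apply/rowP => i; rewrite [RHS]mxE SsymE !E mulr_sumr -sumrN.
apply: eq_bigr => j _; rewrite partial_HamS.
by case: i => -[|[|[|[|//]]]] i4; case: j => -[|[|[|[|//]]]] j4 /=;
  rewrite ?inE /= ?(expr0, expr1, subr0, sub0r, mul1r, mulN1r, mul0r, oppr0, opprK).
Qed.

(** The sign produced by reversing time cancels the one in [vector_fieldS]. Singletons as sets of
    times make the statement pointwise, as the junctions of arcs require. *)
Lemma solution_reflect (q : R -> 'rV[R]_4) (c t : R) :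
  solution_on mu [set c - t] q -> solution_on mu [set t] (fun y => Ssym (q (c - y))).
Proof.
move=> /(_ _ erefl) [n1 n2 dq] _ ->; split; rewrite ?r1S ?r2S//.
rewrite vector_fieldS; apply: is_derive_mx => i j; rewrite ord1.
under eq_fun do rewrite SsymE.
have := is_derive_mx_coef 0 j dq.
set f := fun y => q y 0 j; set d := vector_field _ _ => df.
have h : is_derive t 1 (fun y : R => c - y) (-1).
  rewrite -sub0r; exact: (is_deriveB (is_derive_cst c t 1) (is_derive_id t 1)).
have h2 := @is_derive1_comp _ f (fun y => c - y) t _ _ df h.
apply: (is_derive_eq
  (is_deriveZ ((-1) ^+ ((j : nat) \in [:: 1; 2]%N)) h2)).
by rewrite [RHS]mxE SsymE /GRing.scale/= mulrN1 mulrN.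
Qed.

Lemma solution_shift (q : R -> 'rV[R]_4) (c t : R) :
  solution_on mu [set t - c] q -> solution_on mu [set t] (fun y => q (y - c)).
Proof.
move=> /(_ _ erefl) [n1 n2 dq] _ ->; split=> //.
apply: is_derive_mx => i j; rewrite ord1.
have := is_derive_mx_coef 0 j dq.
set f := fun y => q y 0 j; set d := vector_field _ _ => df.
have h : is_derive t 1 (fun y : R => y - c) 1.
  rewrite -[X in is_derive _ _ _ X](subr0 (1 : R)).
  exact: (is_deriveB (is_derive_id t 1) (is_derive_cst c t 1)).
by have := @is_derive1_comp _ f (fun y => y - c) t _ _ df h; rewrite mulr1.
Qed.

End Reversibility.

Lemma near_interval (R : realType) (t d : R) (Q : R -> Prop) : 0 < d ->
  (forall y, t - d < y < t + d -> Q y) -> \forall y \near t, Q y.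
Proof.
move=> d0 h; exists d => // y; rewrite /ball_/= => yt; apply: h.
by move: yt; rewrite ltr_distlC.
Qed.

(** * Unfolding an arc between two fixed points of [S] *)

Section SymmetricExtension.
Variables (R : realType) (mu tau e : R) (q : R -> 'rV[R]_4).
Implicit Types (k : int) (s t : R).

(** For [0 < tau], [m] is [t] modulo [2 tau], taken in [[0, 2 tau)]: the arc is followed on the
    first half of the period and its mirror image is followed backwards on the second. *)
Definition sym_ext (t : R) : 'rV[R]_4 :=
  let m := t - 2 * tau * (Num.floor (t / (2 * tau)))%:~R in
  if m <= tau then q m else Ssym (q (2 * tau - m)).

Lemma sym_extE k s : 0 < tau -> 0 <= s <= tau -> sym_ext (s + 2 * tau * k%:~R) = q s.
Proof.
move=> tau0 /andP[s0 st]; rewrite /sym_ext.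
have -> : Num.floor ((s + 2 * tau * k%:~R) / (2 * tau)) = k.
  have t2 : 0 < 2 * tau by lra.
  apply/eqP; rewrite floor_eq ler_pdivlMr// ltr_pdivrMr// intrD.
  apply/andP; split; lra.
by rewrite addrK st.
Qed.

(** Only for [0 < s < tau] does [- s] modulo [2 tau] exceed [tau]. The end values fall into the
    first branch of [sym_ext], and there the fixed points of [S] enter. *)
Lemma sym_extNE k s :
  0 < tau -> Ssym (q 0) = q 0 -> Ssym (q tau) = q tau ->
  0 <= s <= tau -> sym_ext (- s + 2 * tau * k%:~R) = Ssym (q s).
Proof.
move=> tau0 q0S qtauS /andP[]; rewrite le_eqVlt => /predU1P[<- _|s0].
  by rewrite oppr0 sym_extE ?lexx ?ltW.
rewrite le_eqVlt => /predU1P[->|st].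
  have -> : - tau + 2 * tau * k%:~R = tau + 2 * tau * (k - 1)%:~R.
    by rewrite intrD; ring.
  by rewrite sym_extE ?lexx ?ltW.
rewrite /sym_ext.
have -> : Num.floor ((- s + 2 * tau * k%:~R) / (2 * tau)) = k - 1.
  have t2 : 0 < 2 * tau by lra.
  apply/eqP; rewrite floor_eq ler_pdivlMr// ltr_pdivrMr// !intrD.
  by apply/andP; split; lra.
have -> : - s + 2 * tau * k%:~R - 2 * tau * (k - 1)%:~R = 2 * tau - s.
  by rewrite intrD; ring.
case: ifPn => [|_]; last by congr (Ssym (q _)); ring.
by move=> ?; exfalso; lra.
Qed.

(** [[0, tau]] is a fundamental domain for the group generated by the reflections of time about 0
    and [tau]; the two forms are its translations and its reflections. *)
Lemma fold_ex t : 0 < tau -> exists (k : int) s, 0 <= s <= tau /\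
  (t = s + 2 * tau * k%:~R \/ t = - s + 2 * tau * k%:~R).
Proof.
move=> tau0; have t2 : 0 < 2 * tau by lra.
have := floor_itv (t / (2 * tau)); rewrite ler_pdivlMr// ltr_pdivrMr// intrD.
set k := Num.floor _ => /andP[h1 h2].
have [h|h] := leP (t - 2 * tau * k%:~R) tau.
  exists k, (t - 2 * tau * k%:~R); split; last by left; ring.
  by apply/andP; split; lra.
exists (k + 1), (2 * tau * (k + 1)%:~R - t); rewrite intrD; split; last by right; ring.
by apply/andP; split; lra.
Qed.

Lemma sym_extN t :
  0 < tau -> Ssym (q 0) = q 0 -> Ssym (q tau) = q tau ->
  sym_ext (- t) = Ssym (sym_ext t).
Proof.
move=> tau0 q0S qtauS; have [k [s [hs [->|->]]]] := fold_ex t tau0.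
  have -> : - (s + 2 * tau * k%:~R) = - s + 2 * tau * (- k)%:~R.
    by rewrite intrN; ring.
  by rewrite (sym_extNE _ tau0)// sym_extE.
have -> : - (- s + 2 * tau * k%:~R) = s + 2 * tau * (- k)%:~R.
  by rewrite intrN; ring.
by rewrite (sym_extNE _ tau0)// sym_extE// SsymK.
Qed.

Lemma sym_ext_periodic t :
  0 < tau -> Ssym (q 0) = q 0 -> Ssym (q tau) = q tau ->
  sym_ext (t + 2 * tau) = sym_ext t.
Proof.
move=> tau0 q0S qtauS; have [k [s [hs [->|->]]]] := fold_ex t tau0.
  have -> : s + 2 * tau * k%:~R + 2 * tau = s + 2 * tau * (k + 1)%:~R.
    by rewrite intrD; ring.
  by rewrite !sym_extE.
have -> : - s + 2 * tau * k%:~R + 2 * tau = - s + 2 * tau * (k + 1)%:~R.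
  by rewrite intrD; ring.
by rewrite !(sym_extNE _ tau0).
Qed.

(* The extension agrees near [s + 2 tau k] with a translate of [q] and, on the
   other side of [s = 0] or [s = tau], with a reflection of [q] about the
   corresponding fixed point of [Ssym]; both have the same velocity there, so
   no uniqueness theorem for the differential equation is needed. *)
Lemma sym_ext_solution_pos k s : 0 < e -> solution_on mu `]- e, tau + e[ q ->
  0 < tau -> Ssym (q 0) = q 0 -> Ssym (q tau) = q tau ->
  0 <= s <= tau ->
  solution_on mu [set s + 2 * tau * k%:~R] sym_ext.
Proof.
move=> e0 solq tau0 q0S qtauS hs; have /andP[s0 st] := hs; set c := 2 * tau * k%:~R.
have sq : solution_on mu [set s + c - c] q.
  by move=> _ ->; rewrite addrK; apply: solq; rewrite /= in_itv/=; apply/andP; split; lra.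
have sol1 := solution_shift sq.
suff [q2 [sol2 q2t near2]] : exists q2 : R -> 'rV[R]_4,
    [/\ solution_on mu [set s + c] q2, q2 (s + c) = q s &
     \forall y \near s + c, sym_ext y = q (y - c) \/ sym_ext y = q2 y].
  move=> _ ->; have [n1 n2 d1] := sol1 _ erefl; have [_ _ d2] := sol2 _ erefl.
  have qs : q (s + c - c) = sym_ext (s + c) by rewrite addrK sym_extE.
  have q2s : q2 (s + c) = sym_ext (s + c) by rewrite q2t sym_extE.
  rewrite -qs; split=> //.
  apply: (is_derive_glue d1 _ qs q2s near2).
  by rewrite qs -q2s.
have [s_0|sn0] := eqVneq s 0.
  exists (fun y => Ssym (q (c - y))); split.
  - apply: solution_reflect => _ ->; rewrite s_0 add0r subrr.
    by apply: solq; rewrite /= in_itv/=; apply/andP; split; lra.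
  - by rewrite s_0 add0r subrr.
  apply: (@near_interval _ _ tau) => // y /andP[y1 y2].
  have [yc|yc] := leP c y.
    left; rewrite -[in LHS](subrK c y); apply: sym_extE => //.
    by apply/andP; split; lra.
  right; rewrite -[in LHS](subrK c y) -[y - c]opprB; apply: sym_extNE => //.
  by apply/andP; split; lra.
have [s_t|snt] := eqVneq s tau.
  exists (fun y => Ssym (q (2 * tau + c - y))); split.
  - apply: solution_reflect => _ ->.
    by apply: solq; rewrite /= in_itv/=; apply/andP; split; lra.
  - by rewrite -[in RHS]s_t in qtauS *; rewrite -[RHS]qtauS; congr (Ssym (q _)); lra.
  apply: (@near_interval _ _ tau) => // y /andP[y1 y2].
  have [yc|yc] := leP y (s + c).
    left; rewrite -[in LHS](subrK c y); apply: sym_extE => //.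
    by apply/andP; split; lra.
  right; have {1}-> : y = - (2 * tau + c - y) + 2 * tau * (k + 1)%:~R.
    by rewrite intrD /c; ring.
  by apply: sym_extNE => //; apply/andP; split; lra.
exists (fun y => q (y - c)); split=> //; first by rewrite addrK.
have s_gt0 : 0 < s by rewrite lt_neqAle eq_sym sn0.
have s_ltt : s < tau by rewrite lt_neqAle snt.
apply: (@near_interval _ _ (Num.min s (tau - s))).
  by rewrite lt_min; apply/andP; split; lra.
move=> y hy; left; rewrite -[in LHS](subrK c y); apply: sym_extE => //.
have m1 : Num.min s (tau - s) <= s by rewrite ge_min lexx.
have m2 : Num.min s (tau - s) <= tau - s by rewrite ge_min lexx orbT.
by move: hy => /andP[? ?]; apply/andP; split; lra.
Qed.

Lemma sym_ext_solution : 0 < e -> solution_on mu `]- e, tau + e[ q ->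
  0 < tau -> Ssym (q 0) = q 0 -> Ssym (q tau) = q tau ->
  solution_on mu setT sym_ext.
Proof.
move=> e0 solq tau0 q0S qtauS t _; have [k [s [hs [->|->]]]] := fold_ex t tau0.
  exact: (@sym_ext_solution_pos k s).
(* The remaining times [- s + 2 tau k] are the opposites of times already treated, so reflecting the
   whole extension about 0 reduces to that case. *)
have -> : sym_ext = (fun y => Ssym (sym_ext (0 - y))).
  by apply/funext => y; rewrite sub0r sym_extN// SsymK.
apply: (@solution_reflect _ _ _ 0) => // _ ->.
have -> : 0 - (- s + 2 * tau * k%:~R) = s + 2 * tau * (- k)%:~R.
  by rewrite intrN; ring.
exact: (@sym_ext_solution_pos (- k) s).
Qed.

End SymmetricExtension.

Lemma Ssym_of_section (R : realType) (s : 'rV[R]_3) :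
  s 0 i_px = 0 -> Ssym (of_section s) = of_section s.
Proof.
move=> s0; rewrite /Ssym /of_section /cx /cy /cpx /cpy !vec4E !inordK//= s0.
by rewrite oppr0.
Qed.

Lemma symmetric_return_periodic (R : realType) (mu : R) (s s' : 'rV[R]_3) :
  first_return mu s s' -> s 0 i_px = 0 -> s' 0 i_px = 0 ->
  exists q : R -> 'rV[R]_4,
    [/\ periodic_orbit mu q, S_symmetric q & exists t, q t = of_section s].
Proof.
move=> [q [tau [e [[tau0 e0] solq q0 cyq qtau]]]] sp sp'.
have q0S : Ssym (q 0) = q 0 by rewrite q0 Ssym_of_section.
have qtS : Ssym (q tau) = q tau by rewrite qtau Ssym_of_section.
have E t : 0 <= t <= tau -> sym_ext tau q t = q t.
  by move=> ht; rewrite -(sym_extE q 0 tau0 ht) mulr0 addr0.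
have h0 : 0 <= (0 : R) <= tau by rewrite lexx ltW.
exists (sym_ext tau q); split; last by exists 0; rewrite E.
  split.
  - exact: (sym_ext_solution e0 solq tau0 q0S qtS).
  - by exists (2 * tau) => [|t]; [lra|rewrite (sym_ext_periodic _ tau0 q0S qtS)].
  (* [y] vanishes at time 0 but nowhere strictly between 0 and [tau], so the orbit is not an
     equilibrium. *)
  exists (tau / 2); rewrite !E//; last by apply/andP; split; lra.
  move=> h; have /cyq : 0 < tau / 2 < tau by apply/andP; split; lra.
  by rewrite h q0 /cy vec4E inordK ?eqxx.
by move=> t; rewrite (sym_extN _ tau0 q0S qtS).
Qed.

(** * An implicit function confined to a cone *)

(** Compactness gives one radius for which every ball centred in the rectangle lies in [A]; [clamp]
    finds such a centre close to a given point of the fattened rectangle. *)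
Lemma rectangle_fattening (R : realType) (A : set (R * R)) (xl xu l u : R) :
  xl <= xu -> l <= u -> open A -> `[xl, xu] `*` `[l, u] `<=` A ->
  exists2 d : R, 0 < d &
    forall x i, xl - d < x < xu + d -> l - d < i < u + d -> A (x, i).
Proof.
move=> hx hi oA sA.
have cK : compact (`[xl, xu]%classic `*` `[l, u]%classic).
  by apply: compact_setX; exact: segment_compact.
move/compact_near_coveringP : cK =>
  /(_ R (0^'+) (fun d z => ball z d `<=` A) _ _)[].
  move=> z /sA Az; have := open_nbhs_nbhs (conj oA Az).
  move=> /nbhs_ballP[r /= r0 hr].
  have r20 : 0 < r / 2 by lra.
  exists (ball z (r / 2), [set d | 0 < d < r / 2]).
    split => /=; first exact: nbhsx_ballx.
    exists (r / 2) => //= d; rewrite /ball_/= sub0r normrN => dr d0.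
    by rewrite d0/=; apply: le_lt_trans dr; exact: ler_norm.
  move=> [z' d] /= [bz /andP[d0 dr]] w bw; apply: hr.
  rewrite [r]splitr; apply: ball_triangle bz _.
  exact: le_ball (ltW dr) _ bw.
move=> r /= r0 hr; have r20 : 0 < r / 2 by lra.
exists (r / 2) => // x i /andP[x1 x2] /andP[i1 i2].
have clamp (a b y : R) : a <= b -> a - r / 2 < y -> y < b + r / 2 ->
    exists2 c, a <= c <= b & `|c - y| < r / 2.
  move=> ab ya yb; have [h1|h1] := leP a y; have [h2|h2] := leP y b.
  - by exists y; rewrite ?h1 ?h2// subrr normr0.
  - by exists b; [rewrite ab lexx|rewrite ltr_distlC; apply/andP; split; lra].
  - by exists a; [rewrite ab lexx|rewrite ltr_distlC; apply/andP; split; lra].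
  - by exfalso; lra.
have [cx hcx dx] := clamp _ _ x hx x1 x2.
have [ci hci di] := clamp _ _ i hi i1 i2.
apply: (hr (r / 2) _ r20 (cx, ci)).
- by rewrite /ball_/= sub0r normrN gtr0_norm//; lra.
- by split; rewrite /= in_itv.
- by split.
Qed.

Section ImplicitCone.
Variables (R : realType) (F Fx Fi : R -> R -> R) (al au bl bu M : R).
Let B x i := (al < x < au) /\ (bl < i < bu).

(** Derivatives along affine lines, linear in the direction [(a, b)]: the form that the mean value
    theorem on a segment consumes and that the chain rule along a line delivers. *)
Definition directional_derivatives := forall x i a b t, B (x + t * a) (i + t * b) ->
  is_derive t 1 (fun s : R => F (x + s * a) (i + s * b))
    (a * Fx (x + t * a) (i + t * b) + b * Fi (x + t * a) (i + t * b)).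

Lemma mean_value_box x1 i1 x2 i2 : directional_derivatives ->
  B x1 i1 -> B x2 i2 ->
  exists x i, [/\ B x i, `|x - x1| <= `|x2 - x1|, `|i - i1| <= `|i2 - i1| &
    F x2 i2 - F x1 i1 = (x2 - x1) * Fx x i + (i2 - i1) * Fi x i].
Proof.
move=> dF [/andP[x1l x1u] /andP[i1l i1u]] [/andP[x2l x2u] /andP[i2l i2u]].
have seg (t : R) : 0 <= t <= 1 -> B (x1 + t * (x2 - x1)) (i1 + t * (i2 - i1)).
  move=> /andP[t0 t1].
  have conv (a b u v : R) : a < u < b -> a < v < b -> a < u + t * (v - u) < b.
    by move=> /andP[? ?] /andP[? ?]; have [?|?] := leP u v;
      apply/andP; split; nra.
  by split; apply: conv; apply/andP.
pose f s := F (x1 + s * (x2 - x1)) (i1 + s * (i2 - i1)).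
have fd (t : R) : 0 <= t <= 1 -> is_derive t 1 f
    ((x2 - x1) * Fx (x1 + t * (x2 - x1)) (i1 + t * (i2 - i1)) +
     (i2 - i1) * Fi (x1 + t * (x2 - x1)) (i1 + t * (i2 - i1))).
  by move=> ht; apply: dF; exact: seg.
have [||t] := @MVT_segment R f (fun t =>
    (x2 - x1) * Fx (x1 + t * (x2 - x1)) (i1 + t * (i2 - i1)) +
     (i2 - i1) * Fi (x1 + t * (x2 - x1)) (i1 + t * (i2 - i1))) 0 1 ler01.
- by move=> t; rewrite in_itv/= => /andP[t0 t1]; apply: fd; rewrite !ltW.
- apply: derivable_within_continuous => t; rewrite in_itv/= => /fd[] //.
rewrite in_itv/= => ht; rewrite /f !mul1r !mul0r !addr0 subr0 mulr1 !subrKC => ->.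
have abs_le (y : R) : `|t * y| <= `|y|.
  move: ht => /andP[t0 t1]; rewrite normrM ger0_norm//.
  by rewrite ler_piMl.
exists (x1 + t * (x2 - x1)), (i1 + t * (i2 - i1)); split=> //.
- exact: seg.
- by rewrite addrC addKr.
- by rewrite addrC addKr.
Qed.

(* The zero set of [F] has slope [- Fx / Fi], of absolute value less than [M]. *)
Definition cone_condition := forall x i, B x i -> `|Fx x i| < M * Fi x i.

(** A displacement [(dx, di)] changes [F] by [dx * Fx + di * Fi], which is at least
    [(di - M * |dx|) * Fi]; and [Fi] is positive because [M * Fi] exceeds an absolute value. *)
Lemma cone_monotone x1 i1 x2 i2 : 0 < M -> directional_derivatives ->
  cone_condition -> B x1 i1 -> B x2 i2 ->
  (M * `|x2 - x1| <= i2 - i1 -> F x1 i1 <= F x2 i2) /\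
  (M * `|x2 - x1| < i2 - i1 -> F x1 i1 < F x2 i2).
Proof.
move=> M0 dF cF B1 B2; have [x [i [Bxi _ _ E]]] := mean_value_box dF B1 B2.
have := cF _ _ Bxi; set a := Fx x i; set b := Fi x i => ab.
have b0 : 0 < b by rewrite -(pmulr_rgt0 _ M0); apply: le_lt_trans ab.
have Dx : - (`|x2 - x1| * (M * b)) <= (x2 - x1) * a.
  apply: (@le_trans _ _ (- `|(x2 - x1) * a|)); last by rewrite lerNl -normrN ler_norm.
  by rewrite lerN2 normrM ler_wpM2l// ltW.
rewrite -![F x1 i1 <= _]subr_ge0 -![F x1 i1 < _]subr_gt0 E -/a -/b.
split=> h.
- have : (M * `|x2 - x1|) * b <= (i2 - i1) * b by rewrite ler_wpM2r// ltW.
  by lra.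
- have : (M * `|x2 - x1|) * b < (i2 - i1) * b by rewrite ltr_pM2r.
  by lra.
Qed.

(** On the vertical at [x], [F] is nonpositive on the lower edge of the cone with apex [(x0, i0)]
    and nonnegative on the upper edge. *)
Lemma cone_zero x0 i0 x : 0 < M -> directional_derivatives -> cone_condition ->
  B x0 i0 -> F x0 i0 = 0 ->
  B x (i0 - M * `|x - x0|) -> B x (i0 + M * `|x - x0|) ->
  exists i, [/\ i0 - M * `|x - x0| <= i <= i0 + M * `|x - x0| & F x i = 0].
Proof.
move=> M0 dF cF B0 F0 Bl Bu.
have Mx : 0 <= M * `|x - x0| by rewrite mulr_ge0// ltW.
have [Fl _] := cone_monotone M0 dF cF Bl B0.
have [Fu _] := cone_monotone M0 dF cF B0 Bu.
have {}Fl : F x (i0 - M * `|x - x0|) <= 0.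
  by rewrite -F0; apply: Fl; rewrite distrC; lra.
have {}Fu : 0 <= F x (i0 + M * `|x - x0|).
  by rewrite -F0; apply: Fu; lra.
have [|||i hi Fi0] := @IVT R (F x) (i0 - M * `|x - x0|) (i0 + M * `|x - x0|) 0.
- by lra.
- apply: derivable_within_continuous => i; rewrite in_itv/= => /andP[il iu].
  have FE : (fun s : R => F (x + s * 0) (0 + s * 1)) = F x.
    by apply/funext => s; rewrite mulr0 addr0 add0r mulr1.
  have := dF x 0 0 1 i; rewrite FE mulr0 addr0 add0r mulr1; case=> //.
  move: Bl Bu => [hx /andP[h1 h2]] [_ /andP[h3 h4]].
  by split=> //; apply/andP; split; lra.
- by rewrite ge_min Fl le_max Fu orbT.
by exists i; move: hi; rewrite in_itv.
Qed.

Lemma zeros_lipschitz x1 i1 x2 i2 : 0 < M -> directional_derivatives ->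
  cone_condition -> B x1 i1 -> B x2 i2 -> F x1 i1 = 0 -> F x2 i2 = 0 ->
  `|i2 - i1| <= M * `|x2 - x1|.
Proof.
move=> M0 dF cF B1 B2 F1 F2.
have [_ h1] := cone_monotone M0 dF cF B1 B2.
have [_ h2] := cone_monotone M0 dF cF B2 B1.
rewrite F1 F2 ltxx in h1; rewrite F1 F2 ltxx distrC in h2.
rewrite ler_norml; apply/andP; split.
- by rewrite leNgt; apply/negP => h; suff : false by []; apply: h2; lra.
- by rewrite leNgt; apply/negP => h; suff : false by []; apply: h1; lra.
Qed.

(** By the mean value theorem between two zeros, a difference quotient of [K] is [- Fx / Fi] at an
    intermediate point. The Lipschitz bound on zeros makes that point tend to [(x, K x)], so no
    prior continuity of [K] is assumed. *)
Lemma zeros_derivative (K : R -> R) (ol ou : R) : 0 < M ->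
  directional_derivatives -> cone_condition ->
  (forall x i, B x i -> {for (x, i), continuous (fun z => Fx z.1 z.2 : R)}) ->
  (forall x i, B x i -> {for (x, i), continuous (fun z => Fi z.1 z.2 : R)}) ->
  (forall x, ol < x < ou -> B x (K x) /\ F x (K x) = 0) ->
  forall x, ol < x < ou -> is_derive x 1 K (- Fx x (K x) / Fi x (K x)).
Proof.
move=> M0 dF cF cFx cFi hK x hx; have [Bx Fx0] := hK _ hx.
have Fi_gt0 y i : B y i -> 0 < Fi y i.
  by move=> /cF h; rewrite -(pmulr_rgt0 _ M0); apply: le_lt_trans h.
pose phi (z : R * R) : R := - Fx z.1 z.2 / Fi z.1 z.2.
have cphi : {for (x, K x), continuous phi}.
  apply: cvgM; first by apply: cvgN; exact: cFx.
  by apply: cvgV; [rewrite gt_eqF// Fi_gt0|exact: cFi].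
apply/is_derive1_caratheodory.
exists (fun z => if z == x then phi (x, K x) else (K z - K x) / (z - x)).
split=> [z||] /=; last by rewrite eqxx.
  case: eqP => [->|/eqP zx]; first by rewrite !subrr mulr0.
  by rewrite divfK// subr_eq0.
apply/cvgrPdist_lt => e e0.
move/cvgrPdist_lt : cphi => /(_ e e0) /nbhs_ballP[r /= r0 hr].
have nO : \forall z \near x, ol < z < ou.
  have : open_nbhs x `]ol, ou[%classic by split; [exact: interval_open|rewrite /= in_itv].
  by move/open_nbhs_nbhs; apply: filterS => z; rewrite /= in_itv.
(* [r / (1 + M)] and its product with [M] are positive and add up to [r]. *)
have [r' r'0 hr'] : exists2 r' : R, 0 < r' & r' <= r /\ M * r' <= r.
  have M1 : 0 < 1 + M by lra.
  exists (r / (1 + M)); first by rewrite divr_gt0.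
  have E : r / (1 + M) + M * (r / (1 + M)) = r by field; rewrite gt_eqF.
  have : 0 < r / (1 + M) by rewrite divr_gt0.
  have : 0 < M * (r / (1 + M)) by rewrite mulr_gt0// divr_gt0.
  by split; lra.
have nr : \forall z \near x, `|x - z| < r' by exact: nbhsx_ballx.
apply: filterS2 nO nr => z hz zr /=.
rewrite eqxx; case: eqP => [_|/eqP zx]; first by rewrite subrr normr0.
have [Bz Fz0] := hK _ hz.
have [y [i [Byi y1 i1]]] := mean_value_box dF Bx Bz.
rewrite Fx0 Fz0 subrr => E.
have zx0 : z - x != 0 by rewrite subr_eq0.
have -> : (K z - K x) / (z - x) = phi (y, i).
  have b0 : Fi y i != 0 by rewrite gt_eqF// Fi_gt0.
  apply/eqP; rewrite /phi/= eqr_div// mulNr -subr_eq0 opprK.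
  by apply/eqP; rewrite [RHS]E; ring.
have [yr ir] : `|y - x| < r /\ `|i - K x| < r; last first.
  by apply: hr; rewrite distrC in yr; rewrite distrC in ir; split.
split.
- by apply: le_lt_trans y1 _; rewrite distrC; lra.
- apply: le_lt_trans i1 _.
  have L := zeros_lipschitz M0 dF cF Bx Bz Fx0 Fz0.
  apply: le_lt_trans L _; rewrite distrC.
  have : M * `|x - z| < M * r' by rewrite ltr_pM2l.
  lra.
Qed.

End ImplicitCone.

Lemma implicit_cone (R : realType) (F Fx Fi : R -> R -> R) (A : set (R * R))
    (M xl xu l0 u0 l1 u1 x0 i0 : R) :
  xl < xu -> x0 = (xl + xu) / 2 -> l0 <= i0 <= u0 ->
  M * ((xu - xl) / 2) <= u1 - u0 -> M * ((xu - xl) / 2) <= l0 - l1 ->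
  0 < M -> open A -> `[xl, xu] `*` `[l1, u1] `<=` A ->
  (forall x i a b t, A (x + t * a, i + t * b) ->
    is_derive t 1 (fun s : R => F (x + s * a) (i + s * b))
      (a * Fx (x + t * a) (i + t * b) + b * Fi (x + t * a) (i + t * b))) ->
  (forall z, A z -> {for z, continuous (fun z => Fx z.1 z.2 : R)}) ->
  (forall z, A z -> {for z, continuous (fun z => Fi z.1 z.2 : R)}) ->
  (forall x i, A (x, i) -> `|Fx x i| < M * Fi x i) ->
  F x0 i0 = 0 ->
  exists (K : R -> R) (e : R), [/\ 0 < e,
    forall x, xl - e < x < xu + e -> [/\ A (x, K x), F x (K x) = 0 &
      is_derive x 1 K (- Fx x (K x) / Fi x (K x))] &
    forall x, xl <= x <= xu -> l1 <= K x <= u1].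
Proof.
move=> hx x0E /andP[i0l i0u] hu hl M0 oA sA dF cFx cFi cF F0.
have M2 : 0 < M * ((xu - xl) / 2) by rewrite mulr_gt0//; lra.
have [||d d0 hd] := rectangle_fattening _ _ oA sA; [exact: ltW|by lra|].
pose al := xl - d; pose au := xu + d; pose bl := l1 - d; pose bu := u1 + d.
have BA x i : (al < x < au) /\ (bl < i < bu) -> A (x, i) by case; exact: hd.
have dF' : directional_derivatives F Fx Fi al au bl bu.
  by move=> x i a b t /BA; exact: dF.
have cF' : cone_condition Fx Fi al au bl bu M by move=> x i /BA; exact: cF.
have M1 : 0 < 1 + M by lra.
(* Beyond [I] by [e] the cone rises by at most [M * e] more; [e + M * e = d] keeps it inside the
   fattened rectangle. *)
pose e := d / (1 + M).
have e0 : 0 < e by rewrite divr_gt0.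
have Me : 0 < M * e by rewrite mulr_gt0.
have eE : e + M * e = d by rewrite /e; field; rewrite gt_eqF.
have dist x w : 0 <= w -> xl - w <= x <= xu + w ->
    M * `|x - x0| <= M * ((xu - xl) / 2) + M * w.
  move=> w0 /andP[h1 h2]; rewrite -mulrDr; apply: ler_wpM2l; first exact: ltW.
  rewrite ler_distl x0E.
  by apply/andP; split; lra.
(* The implication under the existential, with default 0 off the interval, lets choice produce a
   total function. *)
have key x : exists i, xl - e < x < xu + e ->
    i0 - M * `|x - x0| <= i <= i0 + M * `|x - x0| /\ F x i = 0.
  have [h|h] := pselect (xl - e < x < xu + e); last by exists 0 => /h.
  have Mx : 0 <= M * `|x - x0| by rewrite mulr_ge0// ltW.
  move: (h) => /andP[h1 h2].
  have Dx : M * `|x - x0| <= M * ((xu - xl) / 2) + M * e.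
    by apply: dist; [exact: ltW|rewrite !ltW].
  have [||||i [hi Fi0]] := @cone_zero _ F Fx Fi al au bl bu M x0 i0 x M0 dF' cF'.
  - by split; apply/andP; split; rewrite /al /au /bl /bu; lra.
  - exact: F0.
  - by split; apply/andP; split; rewrite /al /au /bl /bu; lra.
  - by split; apply/andP; split; rewrite /al /au /bl /bu; lra.
  by exists i.
have [K hK] := choice key.
have hB x : xl - e < x < xu + e ->
    ((al < x < au) /\ (bl < K x < bu)) /\ F x (K x) = 0.
  move=> h; have [/andP[k1 k2] ->] := hK _ h; move: (h) => /andP[h1 h2].
  have Dx : M * `|x - x0| <= M * ((xu - xl) / 2) + M * e.
    by apply: dist; [exact: ltW|rewrite !ltW].
  by split=> //; split; apply/andP; split; rewrite /al /au /bl /bu; lra.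
exists K, e; split=> //.
- move=> x h; have [Bx FK] := hB _ h; split=> //; first exact: BA.
  apply: (zeros_derivative M0 dF' cF' _ _ hB) => // y i /BA; [exact: cFx|exact: cFi].
- move=> x /andP[h1 h2]; have [|/andP[k1 k2] _] := hK x.
    by apply/andP; split; lra.
  have Dx : M * `|x - x0| <= M * ((xu - xl) / 2) + M * 0.
    by apply: dist; rewrite // subr0 addr0 h1.
  by apply/andP; split; lra.
Qed.

(** * Interval enclosures and smoothness of the implicit curve *)

(** Since [h] has slope at least 1, moving from [y] by [- h y] brings [h] to zero or across it. *)
Lemma interval_newton (R : realType) (h dh : R -> R) (l u y : R) :
  (forall p, l <= p <= u -> is_derive p 1 h (dh p)) ->
  (forall p, l <= p <= u -> 1 <= dh p) ->
  l <= y <= u -> l <= y - h y <= u -> exists2 p, l <= p <= u & h p = 0.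
Proof.
move=> hd dh1 hy hn.
have cont a b : l <= a -> b <= u -> {within `[a, b], continuous h}.
  move=> la bu; apply: derivable_within_continuous => p; rewrite in_itv/= => /andP[ap pb].
  have [|//] := hd p; apply/andP; split; [exact: le_trans ap|exact: le_trans bu].
have ivt a b : l <= a -> a <= b -> b <= u -> h a <= 0 <= h b ->
    exists2 p, l <= p <= u & h p = 0.
  move=> la ab bu /andP[ha hb].
  have [|p + hp] := @IVT R h a b 0 ab (cont _ _ la bu).
    by rewrite ge_min ha le_max hb orbT.
  rewrite in_itv/= => /andP[ap pb]; exists p => //.
  by rewrite (le_trans la ap) (le_trans pb bu).
move: (hy) (hn) => /andP[y1 y2] /andP[n1 n2].
have mvt a b : l <= a -> a <= b -> b <= u -> b - a <= h b - h a.
  move=> la ab bu; have [||p] := @MVT_segment R h dh a b ab.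
  - move=> p; rewrite in_itv/= => /andP[ap pb]; apply: hd.
    by apply/andP; split; lra.
  - exact: cont.
  rewrite in_itv/= => /andP[ap pb] ->.
  by rewrite -[leLHS]mul1r ler_wpM2r ?subr_ge0// dh1//; apply/andP; split; lra.
have [h0|h0] := leP 0 (h y).
  apply: (ivt (y - h y) y) => //; first by lra.
  rewrite h0 andbT; have := mvt (y - h y) y n1 _ y2; lra.
apply: (ivt y (y - h y)) => //; first by lra.
rewrite ltW//=; have := mvt y (y - h y) y1 _ n2; lra.
Qed.

(** Compactness bounds the image; without a bound, [inf] and [sup] could be default values. *)
Lemma image_enclosure (R : realType) (T : topologicalType) (A : set T) (h : T -> R) x :
  compact A -> (forall x, A x -> {for x, continuous h}) -> A x ->
  inf (h @` A) <= h x <= sup (h @` A).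
Proof.
move=> cA ch Ax.
have : compact (h @` A).
  apply: continuous_compact => //; apply: continuous_in_subspaceT => z.
  by rewrite inE; exact: ch.
move=> /compact_bounded[N [_ /(_ (N + 1))]].
rewrite ltrDl ltr01 => /(_ isT) hN.
have hb y : (h @` A) y -> - (N + 1) <= y <= N + 1 by move=> /hN /=; rewrite -ler_norml.
apply/andP; split.
- apply: ge_inf; last by exists x.
  by exists (- (N + 1)) => y /hb /andP[].
- apply: ub_le_sup; last by exists x.
  by exists (N + 1) => y /hb /andP[].
Qed.

(* [m] is the endpoint of the enclosure closest to [0]; dividing by it removes
   the case distinction on the sign of [h]. *)
Lemma enclosure_unit (R : realType) (T : topologicalType) (A : set T) (h : T -> R) :
  compact A -> (forall x, A x -> {for x, continuous h}) -> A !=set0 ->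
  ~ `[inf (h @` A), sup (h @` A)]%classic 0 ->
  exists m, [/\ `[inf (h @` A), sup (h @` A)]%classic m, m != 0 &
    forall x, A x -> 1 <= h x / m].
Proof.
move=> cA ch [x0 Ax0]; have hA x := @image_enclosure R T A h x cA ch.
have /andP[i0 s0] := hA _ Ax0.
have le_is := le_trans i0 s0.
rewrite /= in_itv/= => /negP; rewrite negb_and -!ltNge => /orP[lt0|lt0].
  exists (inf (h @` A)); split; first by rewrite /= in_itv/= lexx.
    by rewrite gt_eqF.
  by move=> x /hA /andP[? _]; rewrite ler_pdivlMr// mul1r.
exists (sup (h @` A)); split; first by rewrite /= in_itv/= lexx andbT.
  by rewrite lt_eqF.
by move=> x /hA /andP[_ ?]; rewrite ler_ndivlMr// mul1r.
Qed.

(** * Chain rule and smoothness along a graph in the plane [p_x = 0] *)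

Section Graph.
Variable R : realType.
Implicit Types (f g : 'rV[R]_3 -> R) (W : set 'rV[R]_3).

Lemma is_derive_comp_row n (f : 'rV[R]_n.+1 -> R) (c : R -> 'rV[R]_n.+1) t dc :
  differentiable f (c t) -> is_derive t 1 c dc ->
  is_derive t 1 (fun s => f (c s)) (\sum_i dc 0 i * partial i f (c t)).
Proof.
move=> df [dct dcE].
have cd : differentiable c t by apply/derivable1_diffP.
have fcd : differentiable (f \o c) t by exact: differentiable_comp.
split; first by apply/derivable1_diffP.
rewrite -[LHS]/('D_1 (f \o c) t) deriveE// diff_comp//= -(@deriveE _ _ _ c t 1 cd) dcE.
rewrite [X in 'd f _ X](row_sum_delta dc) linear_sum; apply: eq_bigr => i _.
by rewrite linearZ/= /partial deriveE.
Qed.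

Lemma vec3E (x p : R) :
  vec3 x 0 p = x *: delta_mx 0 i_x + p *: delta_mx 0 i_py.
Proof.
apply/rowP => -[[|[|[|//]]] j3]; rewrite !mxE -!val_eqE/= !inordK//=;
  by rewrite ?(mulr0, mulr1, addr0, add0r).
Qed.

Lemma vec3_coef (x p : R) : [/\ vec3 x 0 p 0 i_x = x,
  vec3 x 0 p 0 i_px = 0 & vec3 x 0 p 0 i_py = p].
Proof. by rewrite !mxE !inordK. Qed.

Lemma is_derive_vec3 f (x p : R -> R) (dx dp t : R) :
  differentiable f (vec3 (x t) 0 (p t)) ->
  is_derive t 1 x dx -> is_derive t 1 p dp ->
  is_derive t 1 (fun s => f (vec3 (x s) 0 (p s)))
    (dx * partial i_x f (vec3 (x t) 0 (p t)) +
     dp * partial i_py f (vec3 (x t) 0 (p t))).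
Proof.
move=> df hx hp.
have dc : is_derive t 1 (fun s => vec3 (x s) 0 (p s)) (vec3 dx 0 dp).
  apply: is_derive_mx => i j; rewrite ord1 mxE.
  under eq_fun do rewrite mxE.
  by case: j => -[|[|[|//]]] //= _; exact: is_derive_cst.
have := @is_derive_comp_row 2 f (fun s => vec3 (x s) 0 (p s)) t _ df dc.
rewrite !big_ord_recl big_ord0 addr0.
have [e1 e2 e3] := vec3_coef dx dp.
have -> : (ord0 : 'I_3) = i_x by apply/val_inj; rewrite /= inordK.
have -> : lift i_x (ord0 : 'I_2) = i_px by apply/val_inj; rewrite /= !inordK.
have -> : lift i_x (lift (ord0 : 'I_2) ord0) = i_py by apply/val_inj; rewrite /= !inordK.
by rewrite e1 e2 e3 mul0r add0r.
Qed.

Lemma continuous_vec3 (T : topologicalType) (x p : T -> R) (z : T) :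
  {for z, continuous x} -> {for z, continuous p} ->
  {for z, continuous (fun w => vec3 (x w) 0 (p w))}.
Proof.
move=> cx cp.
have -> : (fun w => vec3 (x w) 0 (p w)) =
    (fun w => x w *: delta_mx 0 i_x + p w *: (delta_mx 0 i_py : 'rV[R]_3)).
  by apply/funext => w; rewrite vec3E.
by apply: cvgD; apply: cvgZr_tmp.
Qed.

(* Along the zero set of [g] one has [K' = - g_x / g_py], so these functions are
   closed under differentiation; as they contain [K'], [K] is smooth. *)
Inductive graph_algebra g (c : R -> 'rV[R]_3) : (R -> R) -> Prop :=
| GraphCst k : graph_algebra g c (fun=> k)
| GraphPartial s : graph_algebra g c (fun x => foldr (@partial R 2) g s (c x))
| GraphInv : graph_algebra g c (fun x => (partial i_py g (c x))^-1)
| GraphAdd h1 h2 : graph_algebra g c h1 -> graph_algebra g c h2 ->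
    graph_algebra g c (fun x => h1 x + h2 x)
| GraphMul h1 h2 : graph_algebra g c h1 -> graph_algebra g c h2 ->
    graph_algebra g c (fun x => h1 x * h2 x).

Section ImplicitSmooth.
Variables (g : 'rV[R]_3 -> R) (W : set 'rV[R]_3) (O : set R) (K : R -> R).
Let c x := vec3 x 0 (K x).
Let dK x := - partial i_x g (c x) / partial i_py g (c x).

Lemma graph_algebra_slope : graph_algebra g c dK.
Proof.
have -> : dK = fun x => (-1 * partial i_x g (c x)) * (partial i_py g (c x))^-1.
  by apply/funext => x; rewrite mulN1r.
apply: GraphMul; last exact: GraphInv.
by apply: GraphMul; [exact: GraphCst|exact: (GraphPartial g c [:: i_x])].
Qed.

Lemma graph_algebra_derive h : smooth_on W g ->
  (forall x, O x -> [/\ W (c x), partial i_py g (c x) != 0 &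
    is_derive x 1 K (dK x)]) ->
  graph_algebra g c h ->
  exists2 h', graph_algebra g c h' & forall x, O x -> is_derive x 1 h (h' x).
Proof.
move=> sg hK.
(* The chain rule along [c], whose velocity is [(1, 0, dK)]. *)
pose dpart s x := 1 * foldr (@partial R 2) g (i_x :: s) (c x) +
  dK x * foldr (@partial R 2) g (i_py :: s) (c x).
have dpart_alg s : graph_algebra g c (dpart s).
  apply: GraphAdd; apply: GraphMul; try exact: GraphPartial.
    exact: GraphCst.
  exact: graph_algebra_slope.
have dpartP s x : O x ->
    is_derive x 1 (fun x => foldr (@partial R 2) g s (c x)) (dpart s x).
  move=> /hK[Wx _ dKx].
  exact: (is_derive_vec3 (sg s _ Wx) (is_derive_id _ _) dKx).
elim=> [k|s||h1 h2 _ [h1' a1 d1] _ [h2' a2 d2]|h1 h2 a1 [h1' b1 d1] a2 [h2' b2 d2]].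
- by exists (fun=> 0); [exact: GraphCst|move=> x _; exact: is_derive_cst].
- by exists (dpart s); [exact: dpart_alg|exact: dpartP].
- exists (fun x => (-1 * dpart [:: i_py] x) *
     ((partial i_py g (c x))^-1 * (partial i_py g (c x))^-1)).
    apply: GraphMul; last by apply: GraphMul; exact: GraphInv.
    by apply: GraphMul; [exact: GraphCst|exact: dpart_alg].
  move=> x Ox; have [_ gp _] := hK _ Ox.
  apply: (is_derive_eq (is_deriveV gp (dpartP [:: i_py] x Ox))).
  by rewrite /GRing.scale/= -exprVn expr2; ring.
- exists (fun x => h1' x + h2' x); first exact: GraphAdd.
  by move=> x Ox; apply: is_deriveD; [exact: d1|exact: d2].
- exists (fun x => h1 x * h2' x + h2 x * h1' x).
    by apply: GraphAdd; apply: GraphMul.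
  by move=> x Ox; apply: is_deriveM; [exact: d1|exact: d2].
Qed.

Lemma implicit_smooth n : open O -> smooth_on W g ->
  (forall x, O x -> [/\ W (c x), partial i_py g (c x) != 0 &
    is_derive x 1 K (dK x)]) ->
  forall x, O x -> derivable (derive1n n K) x 1.
Proof.
move=> oO sg hK.
suff [h _ hd] : exists2 h, graph_algebra g c h &
    forall x, O x -> is_derive x 1 (derive1n n K) (h x).
  by move=> x /hd[].
elim: n => [|n [h ah hd]].
  by exists dK; [exact: graph_algebra_slope|move=> x /hK[]].
have [h' ah' hd'] := graph_algebra_derive sg hK ah.
exists h' => // x Ox; rewrite derive1nS.
(* The iterated derivative is known to equal [h] on [O] only; openness makes this an equality near
   [x]. *)
apply: near_eq_is_derive (hd' _ Ox).
have := open_nbhs_nbhs (conj oO Ox); apply: filterS => y Oy.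
by rewrite derive1E; have [_ ->] := hd _ Oy.
Qed.

End ImplicitSmooth.
End Graph.

Theorem lemma3p1 (R : realType) (mu : R) (hmu : 0 < mu < 1)
  (* I = [xl, xu], J0 = [l0, u0], J1 = [l1, u1] *)
  (xl xu l0 u0 l1 u1 x0 py0 a : R)
  (hI : xl < xu) (hJ0 : l0 < u0) (hJ1 : l1 < u1)
  (hx0 : x0 = (xl + xu) / 2)
  (hp0 : py0 = (l0 + u0) / 2) (hp1 : py0 = (l1 + u1) / 2)
  (I J0 J1 : set R)
  (defI : I = `[xl, xu]%classic) (defJ0 : J0 = `[l0, u0]%classic)
  (defJ1 : J1 = `[l1, u1]%classic)
  (hJ : J0 `<=` J1)
  (U0 U : set 'rV[R]_3)
  (defU0 : U0 = U0_set x0 J0) (defU : U = U_set x0 a I J1)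
  (P : 'rV[R]_3 -> 'rV[R]_3) (W : set 'rV[R]_3)
  (hW : open W) (hU0W : U0 `<=` W) (hUW : U `<=` W)
  (hP : forall s, W s -> first_return mu s (P s))
  (hPsmooth : smooth_map_on W P)
  (hden0 : ~ dP_encl P U0 i_px i_py 0)
  (hden : ~ dP_encl P U i_px i_py 0)
  (N : set R)
  (defN : N = [set py0 - z | z in
     iquot [set P (vec3 x0 0 py0) 0 i_px] (dP_encl P U0 i_px i_py)])
  (hN : N `<=` J0)
  (alphas : set R)
  (defalphas : alphas = [set - z | z in
     iquot (dP_encl P U i_px i_x) (dP_encl P U i_px i_py)])
  (halphas : forall alpha, alphas alpha ->
     `|alpha - a| < ((u1 - l1) - (u0 - l0)) / (xu - xl)) :
  exists kappa : R -> R,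
    smooth_near I kappa /\
    forall x, I x ->
      [/\ exists q : R -> 'rV[R]_4,
            [/\ periodic_orbit mu q, S_symmetric q &
                exists t, q t = vec4 x 0 0 (kappa x)],
          alphas (derive1 kappa x) &
          (@of_section R @` U) (vec4 x 0 0 (kappa x))].
Proof.
subst U0 U alphas N I J0 J1.
pose g s := P s 0 i_px.
have sg : smooth_on W g by exact: hPsmooth.
pose gx := partial i_x g; pose gp := partial i_py g.
have dg s : W s -> differentiable g s by exact: (sg [::]).
have cgx s : W s -> {for s, continuous gx}.
  by move=> Ws; apply: differentiable_continuous; exact: (sg [:: i_x]).
have cgp s : W s -> {for s, continuous gp}.
  by move=> Ws; apply: differentiable_continuous; exact: (sg [:: i_py]).
pose c (z : R * R) := vec3 z.1 0 (a * (z.1 - x0) + z.2).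
have cc z : {for z, continuous c}.
  apply: continuous_vec3; first exact: cvg_fst.
  apply: cvgD; last exact: cvg_snd.
  apply: cvgM; first exact: cvg_cst.
  by apply: cvgB; [exact: cvg_fst|exact: cvg_cst].
set U0 := U0_set x0 _ in hU0W hden0 hN *.
set U := U_set x0 a _ _ in hUW hden halphas *.
have x0I : xl <= x0 <= xu by apply/andP; split; lra.
have py0J : l0 <= py0 <= u0 by apply/andP; split; lra.
have [l10 u01] : l1 <= l0 /\ u0 <= u1.
  have : `[l0, u0]%classic l0 by rewrite /= in_itv/= lexx ltW.
  move=> /hJ; rewrite /= in_itv/= => /andP[? _].
  have : `[l0, u0]%classic u0 by rewrite /= in_itv/= lexx ltW.
  by move=> /hJ; rewrite /= in_itv/= => /andP[_ ?].
have U0E : U0 = (fun p => vec3 x0 0 p) @` `[l0, u0].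
  by apply/seteqP; split => [s [p hp ->]|s [p hp <-]]; exists p.
have UE : U = c @` (`[xl, xu] `*` `[l1, u1]).
  apply/seteqP; split => s.
    by move=> [x [i [hx hi ->]]]; exists (x, i).
  by move=> [[x i] [hx hi] <-]; exists x, i.
have cU0 : compact U0.
  rewrite U0E; apply: continuous_compact; last exact: segment_compact.
  apply: continuous_in_subspaceT => p _.
  by apply: continuous_vec3; [exact: cvg_cst|exact: cvg_id].
have cU : compact U.
  rewrite UE; apply: continuous_compact; last first.
    by apply: compact_setX; exact: segment_compact.
  by apply: continuous_in_subspaceT => z _; exact: cc.
have cgx_U s : U s -> {for s, continuous gx} by move=> /hUW; exact: cgx.
have cgp_U s : U s -> {for s, continuous gp} by move=> /hUW; exact: cgp.
have cgp_U0 s : U0 s -> {for s, continuous gp} by move=> /hU0W; exact: cgp.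
have U0n : U0 !=set0 by exists (vec3 x0 0 py0), py0; rewrite //= in_itv.
have Un : U !=set0.
  rewrite UE; exists (c (x0, py0)), (x0, py0) => //.
  by split; rewrite /= in_itv//=; apply/andP; split; lra.
have [m0 [m0E m00 hm0]] := enclosure_unit cU0 cgp_U0 U0n hden0.
have [m [mE m_neq0 hm]] := enclosure_unit cU cgp_U Un hden.
have [p0 hp0J gp00] : exists2 p, l0 <= p <= u0 & g (vec3 x0 0 p) / m0 = 0.
  apply: (@interval_newton R (fun p => g (vec3 x0 0 p) / m0)
    (fun p => gp (vec3 x0 0 p) / m0) l0 u0 py0) => //.
  - move=> p hp.
    have Ws : W (vec3 x0 0 p) by apply: hU0W; exists p; rewrite //= in_itv.
    have := is_derive_vec3 (dg _ Ws) (is_derive_cst x0 p 1) (is_derive_id p 1).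
    rewrite mul0r add0r mul1r => h.
    have -> : (fun p => g (vec3 x0 0 p) / m0) = m0^-1 \*: (fun p => g (vec3 x0 0 p)).
      by apply/funext => q; rewrite mulrC.
    by rewrite mulrC; exact: is_deriveZ.
  - by move=> p hp; apply: hm0; exists p; rewrite //= in_itv.
  (* [m0] belongs to the enclosure, so the Newton point with divisor [m0] is a member of [N]. *)
  - have : `[l0, u0]%classic (py0 - g (vec3 x0 0 py0) / m0).
      by apply: hN; exists (g (vec3 x0 0 py0) / m0) => //; exists (g (vec3 x0 0 py0)), m0.
    by rewrite /= in_itv.
have {gp00} gp00 : g (vec3 x0 0 p0) = 0.
  by move/eqP: gp00; rewrite mulf_eq0 invr_eq0 (negPf m00) orbF => /eqP.
pose alpha s := - (gx s / gp s).
have alphaP s : U s -> [set - z | z in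
    iquot (dP_encl P U i_px i_x) (dP_encl P U i_px i_py)] (alpha s).
  move=> Us.
  have ex : dP_encl P U i_px i_x (gx s).
    by rewrite /dP_encl [X in X _]/mkset in_itv; exact: image_enclosure cU cgx_U Us.
  have ep : dP_encl P U i_px i_py (gp s).
    by rewrite /dP_encl [X in X _]/mkset in_itv; exact: image_enclosure cU cgp_U Us.
  exists (gx s / gp s); last by [].
  by exists (gx s), (gp s); split; [exact: ex|exact: ep|reflexivity].
pose M := ((u1 - l1) - (u0 - l0)) / (xu - xl).
(* A strict bound on one absolute value [|alpha - a|] already forces [M] to be positive. *)
have M0 : 0 < M.
  by case: Un => s /alphaP/halphas; apply: le_lt_trans.
have ME : M * (xu - xl) = (u1 - l1) - (u0 - l0).
  by rewrite /M divfK// gt_eqF// subr_gt0.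
(* Dividing by [m] gives [Fi >= 1] on the rectangle whatever the sign of [gp]; the term [a * gp] in
   [Fx] comes from the dependence of [p_y] on [x] in the skew coordinates. *)
pose F x i := g (c (x, i)) / m.
pose Fx x i := (gx (c (x, i)) + a * gp (c (x, i))) / m.
pose Fi x i := gp (c (x, i)) / m.
have cFx z : W (c z) -> {for z, continuous (fun z => Fx z.1 z.2 : R)}.
  move=> Wz; suff : {for z, continuous (fun w => (gx (c w) + a * gp (c w)) / m)} by [].
  apply: cvgM; last exact: cvg_cst.
  apply: cvgD; first exact: continuous_comp (cc z) (cgx _ Wz).
  apply: cvgM; first exact: cvg_cst.
  exact: continuous_comp (cc z) (cgp _ Wz).
have cFi z : W (c z) -> {for z, continuous (fun z => Fi z.1 z.2 : R)}.
  move=> Wz; suff : {for z, continuous (fun w => gp (c w) / m)} by [].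
  apply: cvgM; last exact: cvg_cst.
  exact: continuous_comp (cc z) (cgp _ Wz).
(* The cone inequality is built into the open set so that it survives the fattening of the
   rectangle; it also keeps [gp] away from zero there. *)
pose A := [set z : R * R | W (c z) /\ `|Fx z.1 z.2| < M * Fi z.1 z.2].
have oA : open A.
  rewrite openE => z [Wz hz]; apply: filterI.
    by apply: (cc z); exact: open_nbhs_nbhs.
  have cd : {for z, continuous (fun z => M * Fi z.1 z.2 - `|Fx z.1 z.2| : R)}.
    apply: cvgB; first by apply: cvgM; [exact: cvg_cst|exact: cFi].
    by apply: cvg_norm; exact: cFx.
  have np : nbhs (M * Fi z.1 z.2 - `|Fx z.1 z.2|) [set y : R | 0 < y].
    by apply: open_nbhs_nbhs; split; [exact: open_gt|rewrite /= subr_gt0].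
  have nz : \forall w \near z, 0 < M * Fi w.1 w.2 - `|Fx w.1 w.2| by exact: (cd _ np).
  by near=> w; rewrite -subr_gt0; near: w.
have rectU x i : xl <= x <= xu -> l1 <= i <= u1 -> U (c (x, i)).
  by move=> hx hi; rewrite UE; exists (x, i) => //; split; rewrite /= in_itv.
have sA : `[xl, xu] `*` `[l1, u1] `<=` A.
  move=> [x i] []; rewrite /= !in_itv/= => hx hi.
  have Us := rectU _ _ hx hi; split; first exact: hUW.
  have gm1 := hm _ Us; have := halphas _ (alphaP _ Us).
  rewrite -/M /=; set s := c (x, i) in Us gm1 *.
  have gmp : 0 < gp s / m by apply: lt_le_trans gm1.
  have gp0 : gp s != 0 by apply: contraTneq gmp => ->; rewrite mul0r ltxx.
  (* With this identity, multiplying [|alpha - a| < M] by the positive [Fi] is the cone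
     inequality. *)
  have -> : Fx x i = - (alpha s - a) * (gp s / m).
    by rewrite /Fx /alpha -/s; field; rewrite m_neq0.
  by rewrite normrM normrN (gtr0_norm gmp) => h; rewrite ltr_pM2r.
have Agp z : A z -> gp (c z) != 0.
  move=> [_]; case: z => x i /= h.
  have : 0 < M * Fi x i by apply: le_lt_trans h.
  by apply: contraTneq => E; rewrite /Fi E mul0r mulr0 ltxx.
have [|||||||K [e [e0 hK KJ]]] :=
  @implicit_cone R F Fx Fi A M xl xu l0 u0 l1 u1 x0 p0 hI hx0 hp0J _ _ M0 oA sA.
- lra.
- lra.
- move=> x i a' b t /= [Wt _].
  have dx : is_derive t 1 (fun s : R => x + s * a') a' by exact: is_derive_affine.
  have dp : is_derive t 1 (fun s : R => a * (x + s * a' - x0) + (i + s * b)) (a * a' + b).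
    have -> : (fun s : R => a * (x + s * a' - x0) + (i + s * b)) =
        (fun s => (a * (x - x0) + i) + s * (a * a' + b)).
      by apply/funext => s; ring.
    exact: is_derive_affine.
  have -> : (fun s : R => F (x + s * a') (i + s * b)) = m^-1 \*:
      (fun s => g (vec3 (x + s * a') 0 (a * (x + s * a' - x0) + (i + s * b)))).
    by apply/funext => s; rewrite /F mulrC.
  apply: (is_derive_eq (is_deriveZ m^-1
    (@is_derive_vec3 R g (fun s => x + s * a')
      (fun s => a * (x + s * a' - x0) + (i + s * b)) _ _ _ (dg _ Wt) dx dp))).
  rewrite /Fx /Fi -/gx -/gp /c /GRing.scale/=.
  by move: (gx _) (gp _) => ? ?; field.
- by move=> z [Wz _]; exact: cFx.
- by move=> z [Wz _]; exact: cFi.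
- by move=> x i [].
- by rewrite /F /c /= subrr mulr0 add0r gp00 mul0r.
pose kappa x := a * (x - x0) + K x.
have dkappa x : xl - e < x < xu + e ->
    [/\ W (vec3 x 0 (kappa x)), gp (vec3 x 0 (kappa x)) != 0 &
      is_derive x 1 kappa
        (- gx (vec3 x 0 (kappa x)) / gp (vec3 x 0 (kappa x)))].
  move=> /hK[Az _ dK]; have gp0 := Agp _ Az.
  split=> //; first by case: Az.
  have kE : (fun y => - (a * x0) + y * a) + K = kappa.
    by apply/funext => y; rewrite -[LHS]/(- (a * x0) + y * a + K y) /kappa; ring.
  have := is_deriveD (is_derive_affine (- (a * x0)) a x) dK; rewrite kE => dk.
  (* Undoing the skew adds [a] to [- Fx / Fi]; this cancels the term [a * gp], and the scale [m]
     drops out of the quotient. *)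
  apply: (is_derive_eq dk).
  rewrite -[vec3 _ _ _]/(c (x, K x)) /Fx /Fi.
  by move: (gx _) (gp _) gp0 => ? ? gp0; field; rewrite m_neq0 gp0.
exists kappa; split.
  exists `]xl - e, xu + e[%classic; split.
  - exact: interval_open.
  - by move=> x; rewrite /= !in_itv/= => /andP[? ?]; apply/andP; split; lra.
  move=> n x xO; apply: (@implicit_smooth R g W _ kappa n _ sg _ x xO).
    exact: interval_open.
  by move=> y; rewrite /= in_itv/=; exact: dkappa.
move=> x; rewrite /= in_itv/= => hx.
have Us : U (vec3 x 0 (kappa x)) by exact: (rectU _ _ hx (KJ _ hx)).
have hxe : xl - e < x < xu + e by move: hx => /andP[? ?]; apply/andP; split; lra.
have [e1 e2 e3] := vec3_coef x (kappa x).
have qE : of_section (vec3 x 0 (kappa x)) = vec4 x 0 0 (kappa x).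
  by rewrite /of_section e1 e2 e3.
split; last by exists (vec3 x 0 (kappa x)).
- rewrite -qE; apply: symmetric_return_periodic (hP _ (hUW _ Us)) e2 _.
  have [_ + _] := hK _ hxe; rewrite /F => /eqP.
  by rewrite mulf_eq0 invr_eq0 (negPf m_neq0) orbF => /eqP.
- have [_ _ [_ dk]] := dkappa _ hxe; rewrite derive1E dk mulNr.
  exact: alphaP.
Unshelve. all: by end_near. Qed.
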